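(* Let $p\ge 1$, $s>1$, $\varepsilon>0$, let $\tau\in\mathcal{T}([0,1];s,\varepsilon)$, and let $q$ be a noise profile. Assume that $\tau$ satisfies the Lasota--Yorke condition with constants $\alpha_0, C_0$, and that the joint expansion--kernel condition $\alpha_0<1/\widetilde{C}_1$ holds. Then for each $\delta\in(0,1/4)$ the operator $P_\delta=Q_\delta P_\tau$ admits an invariant density $h_\delta\in BV_{1,1/p}(I)$, that is, a function such that $$P_\delta h_\delta=h_\delta,\qquad h_\delta\ge 0,\qquad \|h_\delta\|_1=1 .$$
   Context: Let $I=[0,1]$, let $m$ be Lebesgue measure on $I$, and let $\|\cdot\|_1$ be the norm of $L^1(I)$. Oscillation and the space $BV_{1,1/p}(I)$: for measurable $f:I\to\mathbb{R}$ and $r>0$ put $\operatorname{Osc}(f,r,x)=\sup\{|f(y_1)-f(y_2)|: y_1,y_2\in(x-r,x+r)\cap I\}$ and $\operatorname{Osc}_1(f,r)=\int_I\operatorname{Osc}(f,r,x)\,dm(x)$. For $p\ge1$, $\operatorname{var}_{1,1/p}(f)=\sup_{0<r\le1} r^{-1/p}\operatorname{Osc}_1(f,r)$; $BV_{1,1/p}(I)$ is the set of $f\in L^1(I)$ with $\operatorname{var}_{1,1/p}(f)<\infty$, normed by $\|f\|_{1,1/p}=\operatorname{var}_{1,1/p}(f)+\|f\|_1$. It is a Banach space, continuously embedded in $L^1(I)$, and its unit ball is relatively compact in $L^1(I)$. The class $\mathcal{T}([0,1];s,\varepsilon)$: a map $\tau:I\to I$ belongs to it if there is a finite partition $0=a_0<a_1<\dots<a_q=1$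 (here $q$ is an integer, unrelated to the noise profile below) such that (1) for each $i$, $\tau$ is monotone and $C^{1+\varepsilon}$ on $(a_{i-1},a_i)$, extending continuously to $[a_{i-1},a_i]$; (2) $|\tau'(x)|\ge s>1$ wherever $\tau'$ is defined; (3) $\tau'$ is $\varepsilon$-Hölder continuous on each interval. $P_\tau:L^1(I)\to L^1(I)$ is the Frobenius--Perron operator of $\tau$: $\int_A P_\tau f\,dm=\int_{\tau^{-1}(A)}f\,dm$ for all measurable $A\subset I$. Lasota--Yorke condition for $P_\tau$ (standing assumption): there are constants $0<\alpha_0<1$ and $C_0>0$, depending only on $\tau$, with $\operatorname{var}_{1,1/p}(P_\tau f)\le\alpha_0\|f\|_{1,1/p}+C_0\|f\|_1$ for all $f\in BV_{1,1/p}(I)$; moreover $\alpha_0\le s^{-1/p}$. Noise profile: a $C^1$ function $q:\mathbb{R}\to[0,\infty)$ with $\operatorname{supp}(q)\subset[-1,1]$, $\int_{\mathbb{R}}q(z)\,dz=1$ and $q'\in L^\infty(\mathbb{R})$. For $\delta\in(0,1/4)$ the periodized kernel is $q_\delta^{\mathrm{per}}(x,y)=\sum_{n\in\mathbb{Z}}\delta^{-1}q\left(\frac{x-y+n}{\delta}\right)$, $x,y\in I$, and $(Q_\delta f)(x)=\int_I q_\delta^{\mathrm{per}}(x,y)f(y)\,dy$. Joint expansion--kernel condition (standing assumption): $\alpha_0<1/\widetilde{C}_1$, where $\widetilde{C}_1=(1+2^{1+1/p})\cdot 2^{1/p}\max\{1,4\|q'\|_\infty\}$. *)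

(* Defs.v *)
(* Everything below is about L^1 of the unit interval.  Elements of L^1 are
   represented by real functions on R of which only the values on [0, 1]
   matter, and they are compared almost everywhere on [0, 1]. *)
From HB Require Import structures.
From mathcomp Require Import all_boot all_order all_algebra.
From mathcomp Require Import all_classical all_reals all_analysis.

Set Implicit Arguments.
Unset Strict Implicit.
Unset Printing Implicit Defensive.

Import Order.TTheory GRing.Theory Num.Theory.
Import numFieldNormedType.Exports.

Local Open Scope ring_scope.
Local Open Scope classical_set_scope.

Section definitions.
Context {R : realType}.
Implicit Types (f g h q tau : R -> R) (p s e d : R).

Local Notation mu := (@lebesgue_measure R).

Definition unit_itv : set R := `[0, 1]%classic.
Local Notation I := unit_itv.

Definition L1 f : Prop := mu.-integrable I (EFin \o f).

Definition L1norm f : \bar R := (\int[mu]_(x in I) `|(f x)%:E|)%E.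

Definition Osc f (r x : R) : \bar R :=
  let J := `]x - r, x + r[%classic `&` I in
  ereal_sup [set `|f y1 - f y2|%:E | y1 in J & y2 in J].

Definition Osc1 f (r : R) : \bar R := (\int[mu]_(x in I) Osc f r x)%E.

Definition var_fun p f : \bar R :=
  ereal_sup [set ((r `^ (- p^-1))%:E * Osc1 f r)%E | r in `]0, 1]%classic].

(* Osc is a pointwise supremum, so var_fun is sensitive to changes of f on a
   null set.  The variation of an element of L^1 is the least variation of
   its versions. *)
Definition var p f : \bar R :=
  ereal_inf [set var_fun p g | g in
    [set g | measurable_fun I g /\ ae_eq mu I g f]].

Definition BVnorm p f : \bar R := (var p f + L1norm f)%E.

Definition BV p f : Prop := L1 f /\ (var p f < +oo)%E.

(* A branch on ]a, b[.  Only one-sided limits of tau are required at a and b: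
   tau a and tau b themselves may differ from them.  The last clause is the
   e-Hoelder continuity of the derivative, which is also what the exponent in
   C^(1+e) stands for. *)
Record expanding_branch e tau (a b : R) : Prop := ExpandingBranch {
  branch_monotonic : {in `]a, b[ &, nondecreasing_fun tau} \/
    {in `]a, b[ &, nonincreasing_fun tau} ;
  branch_derivable : {in `]a, b[, forall x, derivable tau x 1} ;
  branch_C1 : {in `]a, b[, continuous (derive1 tau)} ;
  branch_cvgl : cvg (tau x @[x --> a^'+]) ;
  branch_cvgr : cvg (tau x @[x --> b^'-]) ;
  branch_hoelder : exists K : R, {in `]a, b[ &, forall x y,
    `|derive1 tau x - derive1 tau y| <= K * `|x - y| `^ e}
}.

Definition class_T s e tau : Prop :=
  {homo tau : x / I x} /\
  exists (n : nat) (a : nat -> R),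
    [/\ a 0%N = 0, a n = 1,
        forall i, (i < n)%N -> a i < a i.+1,
        forall i, (i < n)%N -> expanding_branch e tau (a i) (a i.+1) &
        1 < s /\ {in `]0, 1[, forall x, derivable tau x 1 -> s <= `|derive1 tau x|}].

Definition is_transfer tau f g : Prop :=
  L1 g /\ forall A, measurable A -> A `<=` I ->
    (\int[mu]_(x in A) (g x)%:E =
     \int[mu]_(x in I `&` tau @^-1` A) (f x)%:E)%E.

(* The Frobenius-Perron operator: some version of the element of L^1 that
   is_transfer characterizes up to null sets. *)
Definition transfer tau f : R -> R := xget (cst 0) (is_transfer tau f).

Record lasota_yorke p s tau (alpha0 C0 : R) : Prop := LasotaYorke {
  ly_alpha_gt0 : 0 < alpha0 ;
  ly_alpha_lt1 : alpha0 < 1 ;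
  ly_C_gt0 : 0 < C0 ;
  ly_ineq : forall f, BV p f ->
    (var p (transfer tau f) <= alpha0%:E * BVnorm p f + C0%:E * L1norm f)%E ;
  ly_alpha_le : alpha0 <= s `^ (- p^-1)
}.

Record noise_profile q : Prop := NoiseProfile {
  noise_ge0 : forall z, 0 <= q z ;
  noise_derivable : forall z, derivable q z 1 ;
  noise_C1 : continuous (derive1 q) ;
  noise_supp : closure [set z | q z != 0] `<=` `[-1, 1]%classic ;
  noise_int : (\int[mu]_z (q z)%:E = 1)%E ;
  noise_deriv_Linfty : derive1 q \in Lfun mu +oo%E
}.

(* A finitely supported sum over the integers, because q has compact
   support. *)
Definition qper q d (x y : R) : R :=
  \sum_(n \in [set: int]) d^-1 * q ((x - y + n%:~R) / d).

Definition noise_op q d f (x : R) : R := \int[mu]_(y in I) (qper q d x y * f y).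

Definition Ctilde1 p q : R :=
  (1 + 2 `^ (1 + p^-1)) * 2 `^ p^-1 *
  Num.max 1 (4 * fine ('N[mu]_+oo [EFin \o derive1 q])%E).

Definition noisy_transfer tau q d f : R -> R := noise_op q d (transfer tau f).

End definitions.

(* Main.v *)
Require Import Defs.
From HB Require Import structures.
From mathcomp Require Import all_boot all_order all_algebra.
From mathcomp Require Import all_classical all_reals all_analysis.
From mathcomp Require Import measurable_realfun ring lra.
Import Order.TTheory GRing.Theory Num.Theory.
Import numFieldNormedType.Exports.
Local Open Scope ring_scope.
Local Open Scope classical_set_scope.

Set Implicit Arguments.
Unset Strict Implicit.
Unset Printing Implicit Defensive.

(** Let T be the operator [f |-> noisy_transfer tau q d f]. By duality,
    integrating the noise kernel against the transfer of [f] is integrating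
    [z |-> qper q d x (tau z)] against [f], so T is an integral operator whose
    kernel K x z = qper q d x (tau z) is nonnegative, bounded, of total mass 1 in
    [x], and Lipschitz in [x] uniformly in [z]. For a fixed level [d] of the noise
    these four properties give the invariant density.

    A kernel that is nonnegative, bounded and stochastic has an invariant density
    ([markov_invariant_density]). The iterates of T from a density bounded by
    sup K are densities with the same bound. Their limit superior g satisfies
    [g <= T g] by dominated convergence and monotonicity of T, and has an integral
    at least 1. As T preserves integrals, T g - g is nonnegative with integral 0,
    so T g = g almost everywhere; then T g is a fixed point everywhere, and a
    multiple of it is a density.

    The fixed point is an average of the functions [K^~ z], so it is Lipschitz,
    and Lipschitz functions are in BV because [p >= 1] ([lipschitz_BV]).

    Two points need care. The operator [transfer] is a chosen solution of the
    equation of the Frobenius-Perron operator, and is 0 when there is none: its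
    existence comes from the Radon-Nikodym theorem, and requires that [tau] be
    nonsingular ([class_T_nonsingular]), which holds because each branch has a
    Lipschitz inverse. The total mass of the periodized kernel on the unit
    interval is 1 since, when [d < 1], only three translates of the noise
    contribute and their integrals telescope ([integral_wrapped_noise]). *)

(** * Invariant densities of bounded stochastic kernels *)

Section markov_density.
Context d (T : measurableType d) (R : realType).
Variable m : {finite_measure set T -> \bar R}.
Implicit Types (f g : T -> R) (B : R).

Lemma bounded_integrable f B : measurable_fun [set: T] f ->
  (forall x, 0 <= f x <= B) -> m.-integrable [set: T] (EFin \o f).
Proof.
move=> mf fB; apply: measurable_bounded_integrable => //.
  by rewrite ltey_eq fin_num_measure.
exists B; split; first exact: num_real.
move=> C BC x _; have /andP[f0 fx] := fB x; rewrite /= ger0_norm//.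
by rewrite (le_trans fx)// ltW.
Qed.

Definition kernel_op (K : T -> T -> R) f (x : T) : R :=
  \int[m]_z (K x z * f z).

Variables (K : T -> T -> R) (M : R).
Hypothesis mK : measurable_fun [set: T * T] (fun w => K w.1 w.2).
Hypothesis K_bnd : forall x z, 0 <= K x z <= M.
Hypothesis K_stoch : forall z, (\int[m]_x (K x z)%:E = 1)%E.

Lemma kernel_integrable f B x : measurable_fun [set: T] f ->
  (forall x, 0 <= f x <= B) ->
  m.-integrable [set: T] (fun z => (K x z * f z)%:E).
Proof.
move=> mf fB; apply: (@bounded_integrable _ (M * B)) => [|z].
  by apply: measurable_funM => //; exact: (measurable_fun_pair2 x mK).
have /andP[K0 KM] := K_bnd x z; have /andP[f0 fM] := fB z.
by rewrite mulr_ge0//= ler_pM.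
Qed.

Lemma kernel_opE f B x : measurable_fun [set: T] f ->
  (forall x, 0 <= f x <= B) ->
  ((kernel_op K f x)%:E = \int[m]_z (K x z * f z)%:E)%E.
Proof.
by move=> mf fB; rewrite /kernel_op /Rintegral fineK//;
  exact: integrable_fin_num (kernel_integrable _ mf fB).
Qed.

Let mKf f : measurable_fun [set: T] f ->
  measurable_fun [set: T * T] (fun w => (K w.1 w.2 * f w.2)%:E).
Proof.
move=> mf; apply/measurable_EFinP; apply: measurable_funM => //.
by apply: measurableT_comp => //; exact: measurable_snd.
Qed.

Let Kf0 f B : (forall x, 0 <= f x <= B) ->
  forall w : T * T, (0 <= (K w.1 w.2 * f w.2)%:E)%E.
Proof.
move=> fB w; have /andP[K0 KM] := K_bnd w.1 w.2; have /andP[f0 fM] := fB w.2.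
by rewrite lee_fin mulr_ge0.
Qed.

Lemma measurable_kernel_op f B : measurable_fun [set: T] f ->
  (forall x, 0 <= f x <= B) -> measurable_fun [set: T] (kernel_op K f).
Proof.
move=> mf fB; apply/measurable_EFinP.
have := @measurable_fun_fubini_tonelli_F _ _ T T R m _ (mKf mf) (Kf0 fB).
by apply: eq_measurable_fun => x _; rewrite /= (kernel_opE _ mf fB).
Qed.

(** Tonelli's theorem: the kernel has total mass 1 in its first variable, so
    the operator preserves integrals. *)
Lemma integral_kernel_op f B : measurable_fun [set: T] f ->
  (forall x, 0 <= f x <= B) ->
  (\int[m]_x (kernel_op K f x)%:E = \int[m]_x (f x)%:E)%E.
Proof.
move=> mf fB; under eq_integral do rewrite (kernel_opE _ mf fB).
rewrite (@fubini_tonelli _ _ T T R m m _ (mKf mf) (Kf0 fB)).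
apply: eq_integral => z _ /=.
have /andP[f0 _] := fB z.
under eq_integral do rewrite EFinM muleC.
rewrite ge0_integralZl ?K_stoch ?mule1 ?lee_fin//.
  by apply/measurable_EFinP; exact: (measurable_fun_pair1 z mK).
by move=> x _; rewrite lee_fin; have /andP[] := K_bnd x z.
Qed.

(** The bound is on the integral of [f], not on [f] itself: the operator sends
    every density below the bound [M] of the kernel. *)
Lemma kernel_op_bnd f B C x : measurable_fun [set: T] f ->
  (forall x, 0 <= f x <= B) -> (\int[m]_x (f x)%:E <= C%:E)%E ->
  0 <= kernel_op K f x <= M * C.
Proof.
move=> mf fB fC.
have M0 : 0 <= M by have /andP[K0] := K_bnd x x; exact: le_trans.
apply/andP; split.
  by apply: Rintegral_ge0 => z _; have := Kf0 fB (x, z); rewrite lee_fin.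
rewrite -lee_fin (kernel_opE _ mf fB).
apply: (@le_trans _ _ (\int[m]_z (M%:E * (f z)%:E))%E).
  apply: ge0_le_integral => //=.
  - by move=> z _; exact: (Kf0 fB (x, z)).
  - exact: (measurable_int _ (kernel_integrable x mf fB)).
  - by apply: emeasurable_funM => //; exact/measurable_EFinP.
  - move=> z _; rewrite -EFinM lee_fin ler_wpM2r//.
      by have /andP[] := fB z.
    by have /andP[] := K_bnd x z.
rewrite ge0_integralZl//; first by rewrite EFinM lee_wpmul2l.
  exact/measurable_EFinP.
by move=> z _; rewrite lee_fin; have /andP[] := fB z.
Qed.

Lemma le_kernel_op f g B x : measurable_fun [set: T] f ->
  measurable_fun [set: T] g -> (forall x, 0 <= f x <= B) ->
  (forall x, 0 <= g x <= B) -> (forall z, f z <= g z) ->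
  kernel_op K f x <= kernel_op K g x.
Proof.
move=> mf mg fB gB fg; apply: le_Rintegral => //.
- exact: kernel_integrable fB.
- exact: kernel_integrable gB.
- by move=> z _; apply: ler_wpM2l => //; have /andP[] := K_bnd x z.
Qed.

(** The difference [kernel_op K f - f] is nonnegative and, as the operator
    preserves integrals, has integral 0; so it vanishes almost everywhere. The
    operator does not see null sets, which turns an almost everywhere equality
    into a pointwise one after one more application. *)
Lemma kernel_op_subinvariant_fixed f B : measurable_fun [set: T] f ->
  (forall x, 0 <= f x <= B) -> (forall x, f x <= kernel_op K f x) ->
  forall x, kernel_op K (kernel_op K f) x = kernel_op K f x.
Proof.
move=> mf fB fKf.
have mT := measurable_kernel_op mf fB.
have iT := integral_kernel_op mf fB.
have [C KfC] : exists C : R, forall x, 0 <= kernel_op K f x <= C.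
  exists (M * fine (\int[m]_x (f x)%:E)%E) => x.
  apply: (kernel_op_bnd _ mf fB).
  by rewrite fineK//; exact: (integrable_fin_num _ (bounded_integrable mf fB)).
have ae : ae_eq m setT (EFin \o (fun x => kernel_op K f x - f x)) (cst 0%E).
  apply/ae_eq_integral_abs => //.
    by apply/measurable_EFinP; exact: measurable_funB.
  under eq_integral => x _ do
    rewrite /= ger0_norm ?subr_ge0// EFinB.
  rewrite integralB//= ?iT ?subee//.
  - exact: (integrable_fin_num _ (bounded_integrable mf fB)).
  - exact: bounded_integrable KfC.
  - exact: bounded_integrable fB.
move=> x; rewrite /kernel_op /Rintegral; congr fine.
apply: ae_eq_integral => //.
- exact: measurable_int (kernel_integrable x mT KfC).
- exact: measurable_int (kernel_integrable x mf fB).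
- apply: filterS ae => z /(_ I) /= [] /eqP; rewrite subr_eq0 => /eqP h _.
  by congr ((K x z * _)%:E).
Qed.

(** The limit superior of the iterates of a density works: by dominated
    convergence for the suprema of the tails (the reverse of Fatou's lemma), the
    operator maps it above the limit superior of the shifted sequence, which is
    itself. The same argument bounds its integral below by 1, so that nothing
    is lost in the limit; a limit inferior could be 0. *)
Lemma exists_subinvariant_density : exists g, [/\ measurable_fun [set: T] g,
  (forall x, 0 <= g x <= M),
  (forall x, g x <= kernel_op K g x) & (1 <= \int[m]_x (g x)%:E)%E].
Proof.
(* Each [K^~ z] is a density bounded by [M]; this bound survives the iteration. *)
pose u n := iter n (kernel_op K) (K^~ point).
have [mu uM u1] : [/\ forall n, measurable_fun [set: T] (u n),
    (forall n x, 0 <= u n x <= M) &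
    forall n, (\int[m]_x (u n x)%:E = 1)%E].
  have H n : [/\ measurable_fun [set: T] (u n), (forall x, 0 <= u n x <= M) &
      (\int[m]_x (u n x)%:E = 1)%E].
    elim: n => [|n [mu uM u1]].
      by rewrite /u; split => //=; exact: (measurable_fun_pair1 point mK).
    split.
    - exact: measurable_kernel_op uM.
    - by move=> x; rewrite -[M]mulr1; apply: (kernel_op_bnd _ mu uM); rewrite u1.
    - by rewrite /u iterS (integral_kernel_op mu uM).
  by split=> n; have [] := H n.
have M0 : 0 <= M by have /andP[K0] := K_bnd point point; exact: le_trans.
have ub x : has_ubound (range (u^~ x)).
  by exists M => _ [n _ <-]; have /andP[] := uM n x.
have lb x : has_lbound (range (u^~ x)).
  by exists 0 => _ [n _ <-]; have /andP[] := uM n x.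
pose g k x := sups (u^~ x) k.
pose h x := inf (range (sups (u^~ x))).
have mg k : measurable_fun [set: T] (g k).
  by apply: measurable_fun_sups => // t _; exact: ub.
have ug k n x : (k <= n)%N -> u n x <= g k x.
  move=> kn; apply: ub_le_sup; last by exists n.
  by exists M => _ [i _ <-]; have /andP[] := uM i x.
have gM k x : 0 <= g k x <= M.
  apply/andP; split.
    by apply: le_trans (ug k k x (leqnn _)); have /andP[] := uM k x.
  apply: ge_sup; first by exists (u k x), k => //=.
  by move=> _ [i _ <-]; have /andP[] := uM i x.
have gh x : g ^~ x @ \oo --> h x by exact: cvg_sups_inf.
have hM x : 0 <= h x <= M.
  apply/andP; split.
    by apply: (cvgr_to_ge (gh x)); apply: nearW => k; have /andP[] := gM k x.
  by apply: (cvgr_to_le (gh x)); apply: nearW => k; have /andP[] := gM k x.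
have mh : measurable_fun [set: T] h.
  by apply: (measurable_fun_cvg mg) => x _; exact: gh.
exists h; split => //.
- move=> x.
    (* Dominated convergence passes to the limit in
     [g k.+1 x <= kernel_op K (g k) x]. *)
  have Kgh : (fun k => kernel_op K (g k) x) @ \oo --> kernel_op K h x.
    apply/fine_cvg; rewrite (kernel_opE _ mh hM).
    apply: (@dominated_cvg _ _ _ m _ _ _ _ (cst (M * M)%:E)) => //.
    + by move=> k; exact: measurable_int (kernel_integrable x (mg k) (gM k)).
    + move=> z _; apply: cvg_EFin; first exact: nearW.
      by apply: cvgM; [exact: cvg_cst | exact: gh].
    + by apply: (@bounded_integrable _ (M * M)) => // z; rewrite mulr_ge0/=.
    + move=> k z _; have /andP[K0 KM] := K_bnd x z.
      have /andP[g0 g1] := gM k z.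
      by rewrite /= lee_fin ger0_norm ?mulr_ge0// ler_pM.
  have gSh : (fun k => g k.+1 x) @ \oo --> h x by rewrite (cvg_shiftS (g ^~ x)).
  apply: (ler_cvg_to gSh Kgh); apply: nearW => k.
  apply: ge_sup; first by exists (u k.+1 x), k.+1 => //=.
  move=> _ [[|n] //= kn <-].
  by apply: (le_kernel_op _ (mu n) (mg k) (uM n) (gM k)) => z; exact: ug.
- have Ig : (fun k => \int[m]_x (g k x)%:E)%E @ \oo --> (\int[m]_x (h x)%:E)%E.
    apply: (@dominated_cvg _ _ _ m _ _ _ _ (cst M%:E)) => //.
    + by move=> k; exact/measurable_EFinP.
    + by move=> z _; apply: cvg_EFin; [exact: nearW | exact: gh].
    + by apply: (@bounded_integrable _ M) => // z; rewrite M0/=.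
    + by move=> k z _; have /andP[g0 g1] := gM k z; rewrite /= lee_fin ger0_norm.
  apply: (cvge_to_ge Ig); apply: nearW => k.
  rewrite -(u1 k); apply: ge0_le_integral => //=.
  + by move=> z _; rewrite lee_fin; have /andP[] := uM k z.
  + exact/measurable_EFinP.
  + exact/measurable_EFinP.
  + by move=> z _; rewrite lee_fin; exact: ug.
Qed.

(** The image of a subinvariant function is invariant, and its integral is at
    least 1, so it can be normalized. *)
Theorem markov_invariant_density : exists (h : T -> R) B,
  [/\ measurable_fun [set: T] h, (forall x, 0 <= h x <= B), (\int[m]_x (h x)%:E = 1)%E &
  forall x, kernel_op K h x = h x].
Proof.
have [g [mg gM gK g1]] := exists_subinvariant_density.
have [I0 I1] : 1 <= fine (\int[m]_x (g x)%:E) /\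
    (fine (\int[m]_x (g x)%:E))%:E = (\int[m]_x (g x)%:E)%E.
  have fI : (\int[m]_x (g x)%:E)%E \is a fin_num.
    exact: (integrable_fin_num _ (bounded_integrable mg gM)).
  by rewrite fineK//; split => //; rewrite -lee_fin fineK.
set c := fine _ in I0 I1.
have c0 : 0 < c by exact: lt_le_trans I0.
have mKg := measurable_kernel_op mg gM.
have Kgc x : 0 <= kernel_op K g x <= M * c.
  by apply: (kernel_op_bnd _ mg gM); rewrite -I1.
have KgK := kernel_op_subinvariant_fixed mg gM gK.
exists (fun x => c^-1 * kernel_op K g x), M; split.
- exact: measurable_funM.
- move=> x; have /andP[p1 p2] := Kgc x.
  by rewrite mulr_ge0 ?invr_ge0 ?(ltW c0)//= mulrC ler_pdivrMr.
- under eq_integral do rewrite EFinM.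
  rewrite ge0_integralZl ?lee_fin ?invr_ge0 ?ltW//.
  + by rewrite (integral_kernel_op mg gM) -I1 -EFinM mulVf ?gt_eqF.
  + exact/measurable_EFinP.
  + by move=> x _; rewrite lee_fin; have /andP[] := Kgc x.
- move=> x; rewrite -[in RHS](KgK x) /kernel_op.
  rewrite -RintegralZl//; last exact: (kernel_integrable x mKg Kgc).
  by apply: eq_Rintegral => z _; rewrite mulrCA.
Qed.

End markov_density.

(** * Densities of image measures, and the transfer operator *)

Section change_of_density.
Context d (T : measurableType d) (R : realType).
Variable mu : {sigma_finite_measure set T -> \bar R}.

(** The image under [t] of the measure of density [h]. The hypotheses are
    arguments because they make it a finite measure. *)
Definition image_density (t : T -> T) (h : T -> R)
    & measurable_fun [set: T] t & (forall x, 0 <= h x)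
    & mu.-integrable [set: T] (EFin \o h) : set T -> \bar R :=
  fun A => (\int[mu]_(x in t @^-1` A) (h x)%:E)%E.

Section image_density_measure.
Variables (t : T -> T) (h : T -> R).
Hypotheses (mt : measurable_fun [set: T] t) (h0 : forall x, 0 <= h x)
  (ih : mu.-integrable [set: T] (EFin \o h)).
Local Notation nu := (image_density mt h0 ih).

Let mpre A : measurable A -> measurable (t @^-1` A).
Proof. by move=> mA; rewrite -[X in measurable X]setTI; exact: mt. Qed.

Let nu0 : nu set0 = 0%E.
Proof. by rewrite /nu preimage_set0 integral_set0. Qed.

Let nu_ge0 A : (0 <= nu A)%E.
Proof. by apply: integral_ge0 => x _; rewrite lee_fin. Qed.

Let nu_sigma_additive : semi_sigma_additive nu.
Proof.
move=> F mF tF mUF; rewrite /nu preimage_bigcup.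
apply: (semi_sigma_additive_nng_induced (f := EFin \o h)) => //.
- exact: measurable_int ih.
- by move=> n; exact: mpre.
- apply/trivIsetP => i j _ _ ij; rewrite -preimage_setI.
  by move/trivIsetP : tF => /(_ _ _ _ _ ij) ->//; rewrite preimage_set0.
- by rewrite -preimage_bigcup; exact: mpre.
Qed.

HB.instance Definition _ := isMeasure.Build _ _ _ nu nu0 nu_ge0
  nu_sigma_additive.

Let nu_fin : fin_num_fun nu.
Proof.
move=> A mA; apply: (integrable_fin_num (mpre mA)).
by apply: integrableS ih => //; exact: mpre.
Qed.

HB.instance Definition _ := Measure_isFinite.Build _ _ _ nu nu_fin.

End image_density_measure.

(** By uniqueness, [k] is almost everywhere the Radon-Nikodym derivative of
    [nu], whose change of variables formula then applies to [k]. *)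
Lemma integral_density (nu : {finite_measure set T -> \bar R}) (k : T -> R)
    (f : T -> \bar R) :
  mu.-integrable [set: T] (EFin \o k) ->
  (forall A, measurable A -> nu A = \int[mu]_(x in A) (k x)%:E)%E ->
  measurable_fun [set: T] f -> (forall x, 0 <= f x)%E ->
  (\int[mu]_x (f x * (k x)%:E) = \int[nu]_x f x)%E.
Proof.
move=> ik nuE mf f0.
have numu : nu `<< mu.
  apply/null_content_dominatesP => A mA A0; rewrite nuE//.
  apply: null_set_integral => //; apply: measurable_funTS.
  exact: measurable_int ik.
have iRN := Radon_Nikodym_SigmaFinite.f_integrable numu.
rewrite -(Radon_Nikodym_SigmaFinite.change_of_variables numu f0)//.
apply: ae_eq_integral => //.
- by apply: emeasurable_funM => //; exact: measurable_int ik.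
- by apply: emeasurable_funM => //; exact: measurable_int iRN.
- suff : ae_eq mu setT (EFin \o k) (Radon_Nikodym_SigmaFinite.f nu mu).
    by apply: filterS => x /[apply] /= ->.
  apply: integral_ae_eq => //.
  + exact: measurable_int iRN.
  + by move=> A _ mA; rewrite -nuE// (Radon_Nikodym_SigmaFinite.f_integral numu).
Qed.

(** Both sides are integrals against the image under [t] of the measure of
    density [h]: the left one because [k] is a density of it, the right one by
    the change of variables for image measures. *)
Lemma integral_image_density (t : T -> T) (h k : T -> R) (f : T -> \bar R) :
  measurable_fun [set: T] t -> (forall x, 0 <= h x) ->
  mu.-integrable [set: T] (EFin \o h) ->
  mu.-integrable [set: T] (EFin \o k) ->
  (forall A, measurable A ->
    \int[mu]_(x in A) (k x)%:E = \int[mu]_(x in t @^-1` A) (h x)%:E)%E ->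
  measurable_fun [set: T] f -> (forall x, 0 <= f x)%E ->
  (\int[mu]_x (f x * (k x)%:E) = \int[mu]_x (f (t x) * (h x)%:E))%E.
Proof.
move=> mt h0 ih ik kE mf f0.
pose nut := image_density mt h0 ih.
pose nu := image_density (@measurable_id _ T setT) h0 ih.
rewrite (@integral_density nut)//; last by move=> A mA; rewrite kE.
rewrite (@integral_density nu h (f \o t))//;
  [|exact: measurableT_comp|by move=> x; exact: f0].
rewrite (_ : (\int[nut]_x f x = \int[pushforward nu t]_x f x)%E)//.
by rewrite ge0_integral_pushforward.
Qed.

Lemma exists_image_density (t : T -> T) (h : T -> R) :
  measurable_fun [set: T] t -> (forall x, 0 <= h x) ->
  mu.-integrable [set: T] (EFin \o h) ->
  (forall A, measurable A -> mu A = 0 ->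
     \int[mu]_(x in t @^-1` A) (h x)%:E = 0)%E ->
  exists k : T -> R, mu.-integrable [set: T] (EFin \o k) /\
   (forall A, measurable A ->
    \int[mu]_(x in A) (k x)%:E = \int[mu]_(x in t @^-1` A) (h x)%:E)%E.
Proof.
move=> mt h0 ih null.
pose nut := image_density mt h0 ih.
have numu : nut `<< mu.
  by apply/null_content_dominatesP => A mA A0; exact: null.
have [k [k0 kfin ik kE]] := radon_nikodym_sigma_finite numu.
have fk : EFin \o (fine \o k) = k by apply/funext => x /=; rewrite fineK.
exists (fine \o k); split; first by rewrite fk.
by move=> A mA; rewrite -[LHS]/(\int[mu]_(x in A) (EFin \o (fine \o k)) x)%E fk -kE.
Qed.

End change_of_density.

Section transfer_operator.
Context (R : realType).
Local Notation mu := (@lebesgue_measure R).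
Local Notation I := (@unit_itv R).
Variables (tau : R -> R).
Hypotheses (tauI : {homo tau : x / I x}) (mtau : measurable_fun I tau)
  (tau_nonsing : forall A, measurable A -> mu A = 0%E ->
    mu (I `&` tau @^-1` A) = 0%E).

Let mI : measurable I.
Proof. exact: measurable_itv. Qed.

(** The duality between the Frobenius-Perron operator and composition with the
    map. Nonsingularity of [tau] is essential: it gives, through Radon-Nikodym,
    a function satisfying [is_transfer], so that [transfer] is not the default
    value 0. Everything is extended by 0 from the unit interval to the line. *)
Lemma integral_transfer (h f : R -> R) : (forall x, I x -> 0 <= h x) ->
  L1 h -> measurable_fun [set: R] f -> (forall x, 0 <= f x) ->
  (\int[mu]_(x in I) (f x * transfer tau h x)%:E =
   \int[mu]_(x in I) (f (tau x) * h x)%:E)%E.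
Proof.
move=> h0 ih mf f0.
pose h' := h \_ I; pose t := tau \_ I.
have It x : I (t x).
  rewrite /t patchE; case: ifPn => [|_]; first by rewrite inE; exact: tauI.
  by rewrite /unit_itv /= in_itv /= lexx ler01.
have mt : measurable_fun [set: R] t by exact/(measurable_restrictT _ mI).
have h'0 x : 0 <= h' x.
  by rewrite /h' patchE; case: ifPn => //; rewrite inE; exact: h0.
have ih' : mu.-integrable [set: R] (EFin \o h').
  by rewrite /h' -restrict_EFin -integrable_mkcond.
have hE A : (\int[mu]_(x in t @^-1` A) (h' x)%:E =
    \int[mu]_(x in I `&` tau @^-1` A) (h x)%:E)%E.
  rewrite integral_mkcond [RHS]integral_mkcond; apply: eq_integral => x _.
  rewrite /h' !patchE; case: (boolP (x \in I)) => [xI|xI]; last first.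
    by rewrite [in RHS]ifF ?if_same//; apply/negP; rewrite in_setI (negPf xI).
  rewrite in_setI xI /=; congr (if _ then _ else _).
  by apply/idP/idP; rewrite !inE /= /t patchE xI.
have [k [ik kE]] : exists k : R -> R, mu.-integrable [set: R] (EFin \o k) /\
   (forall A, measurable A ->
    \int[mu]_(x in A) (k x)%:E = \int[mu]_(x in t @^-1` A) (h' x)%:E)%E.
  apply: (@exists_image_density _ _ R mu t h' mt h'0 ih') => A mA A0.
  rewrite hE; apply: null_set_integral.
  - exact: mtau.
  - apply: (measurable_funS mI) (@subIsetl _ _ _) _.
    exact: measurable_int ih.
  - exact: tau_nonsing.
have [ig gE] : is_transfer tau h (transfer tau h).
  apply: xgetPex; exists k; split.
    exact: integrableS ik.
  by move=> A mA AI; rewrite kE.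
set g := transfer tau h in ig gE *.
have ig' : mu.-integrable [set: R] (EFin \o (g \_ I)).
  by rewrite -restrict_EFin -integrable_mkcond.
have g'E A : measurable A ->
    (\int[mu]_(x in A) ((g \_ I) x)%:E = \int[mu]_(x in t @^-1` A) (h' x)%:E)%E.
  move=> mA.
  transitivity (\int[mu]_(x in A `&` I) (g x)%:E)%E.
    rewrite integral_mkcondr; apply: eq_integral => x _.
    by rewrite !patchE; case: ifP.
  rewrite gE//; last exact: measurableI.
  rewrite hE; congr (integral _ _ _).
  by apply/seteqP; split => [x [Ix [Atx _]]|x [Ix Atx]];
    split => //; split => //; exact: tauI.
have mEf : measurable_fun [set: R] (EFin \o f) by exact/measurable_EFinP.
have e := @integral_image_density _ _ R mu t h' (g \_ I) (EFin \o f) mt h'0 ih' ig'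
  g'E mEf f0.
rewrite integral_mkcond [RHS]integral_mkcond.
transitivity (\int[mu]_x ((f x)%:E * ((g \_ I) x)%:E))%E.
  by apply: eq_integral => x _; rewrite !patchE; case: ifP; rewrite ?mule0.
rewrite [LHS]e; apply: eq_integral => x _.
by rewrite /h' /t !patchE /=; case: ifP; rewrite ?mulr0 ?mule0.
Qed.

End transfer_operator.

(** * Expanding maps pull null sets back to null sets *)

Section nonsingularity.
Context (R : realType).
Local Notation mu := (@lebesgue_measure R).
Local Notation I := (@unit_itv R).

Lemma null_set_ocitv_cover (A : set R) (e : R) : mu A = 0%E -> 0 < e ->
  exists a b : nat -> R, [/\ forall n, a n <= b n,
    A `<=` \bigcup_n `]a n, b n]%classic &
    (\sum_(n <oo) (b n - a n)%:E < e%:E)%E].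
Proof.
move=> A0 e0.
have /ereal_inf_lt[z [/= M [mM AM] sMz ze]] : (mu A < e%:E)%E.
  by rewrite A0 lte_fin.
have /choice[c cP] : forall n, exists ab : R * R, [/\ ab.1 <= ab.2,
    M n = `]ab.1, ab.2]%classic & wlength idfun (M n) = (ab.2 - ab.1)%:E].
  move=> n; have [->|[[a b] /= ab ->]] : M n = set0 \/
      exists2 x : R * R, x.1 < x.2 & M n = `]x.1, x.2]%classic.
    by have := mM n; rewrite /= => /ocitvP.
  - by exists (0, 0) => /=; rewrite wlength0 subrr set_itv_ge// bnd_simp ltxx.
  - by exists (a, b) => /=; rewrite wlength_itv /= lte_fin ab EFinB (ltW ab).
exists (fst \o c), (snd \o c); split.
- by move=> n /=; have [] := cP n.
- by move=> x /AM[n _]; have [_ -> _] := cP n; exists n.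
- apply: le_lt_trans ze; rewrite -sMz; apply: lee_nneseries => i _.
    by rewrite lee_fin subr_ge0; have [] := cP i.
  by have [_ _ ->] := cP i.
Qed.

(** Cover [A] by intervals of small total length. The part of [D] sent into an
    interval of length [l] lies within [c * l] of any of its points, hence in an
    interval of length [2 * c * l]. *)
Lemma lipschitz_inverse_nonsingular (D A : set R) (f : R -> R) (c : R) :
  0 < c -> (forall x y, D x -> D y -> `|x - y| <= c * `|f x - f y|) ->
  measurable (D `&` f @^-1` A) -> mu A = 0%E -> mu (D `&` f @^-1` A) = 0%E.
Proof.
move=> c0 Df mX A0; set X := D `&` _ in mX *.
apply/eqP; rewrite -measure_le0; apply/lee_addgt0Pr => e e0; rewrite add0e.
have [|a [b [ab Aab se]]] := @null_set_ocitv_cover A (e / (2 * c)) A0.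
  by rewrite divr_gt0 ?mulr_gt0.
have /choice[y yP] : forall n, exists y, X `&` f @^-1` `]a n, b n]%classic `<=`
    `[y - c * (b n - a n), y + c * (b n - a n)]%classic.
  move=> n; have [->|/set0P[y [[Dy Ay] yab]]] :=
    eqVneq (X `&` f @^-1` `]a n, b n]%classic) set0; first by exists 0.
  exists y => x [[Dx Ax] xab]; rewrite /= in_itv /= -ler_distlC distrC.
  apply: (le_trans (Df _ _ Dx Dy)); rewrite ler_pM2l//.
  move: xab yab; rewrite /= !in_itv /= => /andP[x1 x2] /andP[y1 y2].
  by rewrite ler_norml; apply/andP; split; lra.
pose Y n := (`[y n - c * (b n - a n), y n + c * (b n - a n)]%classic).
have Xle : (mu X <= \sum_(n <oo) mu (Y n))%E.
  apply: measure_sigma_subadditive => //.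
    by move=> n; exact: measurable_itv.
  move=> x Xx; have [n _ xab] := Aab _ (proj2 Xx).
  by exists n => //; apply: yP.
apply: (le_trans Xle).
have Cle : (\sum_(n <oo) mu (Y n) <=
    \sum_(n <oo) ((2 * c)%:E * (b n - a n)%:E))%E.
  apply: lee_nneseries => // n _; rewrite /Y lebesgue_measure_itv /=.
  have cab : 0 <= c * (b n - a n) by rewrite mulr_ge0 ?subr_ge0 ?(ltW c0).
  by case: ifP => _; rewrite -?EFinD -EFinM lee_fin; lra.
apply: (le_trans Cle); rewrite nneseriesZl; last first.
  by move=> n _; rewrite lee_fin subr_ge0.
rewrite -lee_pdivlMl ?mulr_gt0// -EFinM mulrC.
exact: ltW.
Qed.

Lemma expanding_inverse_lipschitz (f : R -> R) (a b s : R) : 0 < s ->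
  {in `]a, b[, forall x, derivable f x 1} ->
  {in `]a, b[, forall x, s <= `|derive1 f x|} ->
  forall x y, `]a, b[%classic x -> `]a, b[%classic y ->
    `|x - y| <= s^-1 * `|f x - f y|.
Proof.
move=> s0 df sf x y Dx Dy.
wlog xy : x y Dx Dy / x < y.
  move=> H; have [xy|yx|->] := ltgtP x y; first exact: H.
  - by rewrite distrC [X in _ * X]distrC; exact: H.
  - by rewrite !subrr normr0 mulr0.
have sub z : z \in `[x, y]%R -> `]a, b[%classic z.
  move: Dx Dy; rewrite /= !in_itv /= => /andP[ax xb] /andP[ay yb] /andP[xz zy].
  by rewrite (lt_le_trans ax xz) (le_lt_trans zy yb).
have dxy z : z \in `[x, y]%R -> derivable f z 1.
  by move=> /sub zab; apply: df; rewrite inE.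
have [|c cxy fyx] := @MVT R f (derive1 f) x y xy _
    (derivable_within_continuous dxy).
  move=> z /subset_itv_oo_cc zxy; rewrite derive1E.
  exact/derivableP/dxy.
have sc : s <= `|derive1 f c|.
  by apply: sf; rewrite inE; apply: sub; exact: subset_itv_oo_cc cxy.
rewrite distrC [X in _ * X]distrC fyx normrM mulrA ler_peMl//.
by rewrite mulrC ler_pdivlMr// mul1r.
Qed.

Lemma class_T_cover (n : nat) (a : nat -> R) x : a 0%N = 0 -> a n = 1 -> I x ->
  (exists2 i, (i < n)%N & `]a i, a i.+1[%classic x) \/
  (exists2 i, (i <= n)%N & x = a i).
Proof.
move=> a0 an Ix.
have xan : x <= a n by move: Ix; rewrite /unit_itv /= in_itv /= an => /andP[].
have P : exists i, x <= a i by exists n.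
case: (ex_minnP P) => -[|i] xai mini.
  right; exists 0%N => //; apply/eqP; rewrite eq_le xai a0.
  by move: Ix; rewrite /unit_itv /= in_itv /= => /andP[].
have {}mini_n : (i < n)%N := mini _ xan.
have [xe|xne] := eqVneq x (a i.+1); first by right; exists i.+1.
left; exists i => //=; rewrite in_itv /= (lt_neqAle x) xne xai /= andbT ltNge.
by apply/negP => /mini; rewrite ltnn.
Qed.

Section class_T.
Variables (s e : R) (tau : R -> R).
Hypothesis tauT : class_T s e tau.

Let mI : measurable I.
Proof. exact: measurable_itv. Qed.

(** The domain of the map, cut into the open branches and the points of the
    partition: on each piece the map is measurable and expands distances. *)
Lemma class_T_branches : exists E : nat -> set R,
  [/\ forall i, measurable (E i), I = \bigcup_i E i,
      forall i, measurable_fun (E i) tau &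
      forall i x y, E i x -> E i y -> `|x - y| <= s^-1 * `|tau x - tau y|].
Proof.
have [_ [n [a [a0 an ai abr [s1 taus]]]]] := tauT.
have s0 : 0 < s by exact: lt_trans s1.
have aI i : (i <= n)%N -> 0 <= a i <= 1.
  move=> lin; apply/andP; split.
    rewrite -a0; elim: i lin => // i IH lin.
    by apply: le_trans (IH (ltnW lin)) (ltW (ai _ lin)).
  rewrite -an; elim: n lin {an abr} ai => [|m IH].
    by rewrite leqn0 => /eqP ->.
  rewrite leq_eqVlt => /orP[/eqP -> //|lim] ai.
  apply: le_trans (IH _ _) (ltW (ai _ (leqnn _))) => //.
  by move=> j jm; apply: ai; exact: leqW.
have brI i x : (i < n)%N -> `]a i, a i.+1[%classic x -> `]0, 1[%classic x.
  move=> lin; rewrite /= !in_itv /= => /andP[x1 x2].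
  have /andP[p1 _] := aI i (ltnW lin); have /andP[_ p2] := aI i.+1 lin.
  by rewrite (le_lt_trans p1 x1) (lt_le_trans x2 p2).
(* Odd indices enumerate the open branches, even ones the partition points. *)
pose E i := if odd i
  then (if (i./2 < n)%N then `]a i./2, a i./2.+1[%classic else set0)
  else (if (i./2 <= n)%N then [set a i./2] else set0).
exists E; split.
- by move=> i; rewrite /E; case: ifP => _; case: ifP => _ //; exact: measurable_itv.
- apply/seteqP; split => [x Ix|x [i _]].
    have [[i lin xi]|[i lin xi]] := class_T_cover a0 an Ix.
    + by exists i.*2.+1 => //; rewrite /E /= odd_double /= uphalf_double lin.
    + by exists i.*2 => //; rewrite /E odd_double doubleK lin.
  rewrite /E /unit_itv /= in_itv /=; case: ifP => _; case: ifP => //= lin.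
    by move=> /(brI _ _ lin); rewrite /= in_itv /= => /andP[/ltW -> /ltW ->].
  by move=> ->; exact: aI.
- move=> i; rewrite /E; case: ifP => _; case: ifP => lin.
  + apply: open_continuous_measurable_fun; first exact: interval_open.
    move=> x xab; apply: differentiable_continuous; apply/derivable1_diffP.
    by apply: (branch_derivable (abr _ lin)).
  + exact: measurable_fun_set0.
  + exact: measurable_fun_set1.
  + exact: measurable_fun_set0.
- move=> i x y; rewrite /E; case: ifP => _; case: ifP => lin //.
  + have der := branch_derivable (abr _ lin).
    apply: expanding_inverse_lipschitz => // z zab.
    apply: taus; last exact: der.
    by move: zab; rewrite !inE; exact: brI.
  + by move=> -> ->; rewrite !subrr normr0 mulr0.
Qed.

Lemma class_T_measurable : measurable_fun I tau.
Proof.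
have [E [mE -> mt _]] := class_T_branches.
exact/measurable_fun_bigcup.
Qed.

Lemma class_T_nonsingular (A : set R) : measurable A -> mu A = 0%E ->
  mu (I `&` tau @^-1` A) = 0%E.
Proof.
move=> mA A0; have [_ [_ [_ [_ _ _ _ [s1 _]]]]] := tauT.
have [E [mE IE mt Elip]] := class_T_branches.
have mEA i : measurable (E i `&` tau @^-1` A) by exact: mt.
rewrite IE setI_bigcupl; apply/negligibleP; first exact: bigcupT_measurable.
apply: negligible_bigcup => i; apply/negligibleP; first exact: mEA.
apply: (@lipschitz_inverse_nonsingular _ _ _ s^-1);
  [|exact: Elip|exact: mEA|exact: A0].
by rewrite invr_gt0; exact: lt_trans s1.
Qed.

End class_T.

End nonsingularity.

(** * The periodized noise kernel *)

Section noise_kernel.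
Context (R : realType).
Local Notation mu := (@lebesgue_measure R).
Local Notation I := (@unit_itv R).

Section noise_profile.
Variable q : R -> R.
Hypothesis q_noise : noise_profile q.

Let q_ge0 := noise_ge0 q_noise.

Lemma noise_vanish (z : R) : 1 < `|z| -> q z = 0.
Proof.
move=> z1; apply/eqP; apply/negPn/negP => qz.
have : closure [set z | q z != 0] z by exact: subset_closure.
move/(noise_supp q_noise); rewrite /= in_itv /= -ler_norml.
by rewrite leNgt z1.
Qed.

Lemma noise_continuous : continuous q.
Proof.
move=> z; apply: differentiable_continuous; apply/derivable1_diffP.
exact: noise_derivable q_noise z.
Qed.

Lemma noise_bounded : exists M, forall z, q z <= M.
Proof.
have [|c _ cmax] := @EVT_max R q (-1) 1 _ (continuous_subspaceT noise_continuous).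
  lra.
exists (q c) => z; have [z1|z1] := leP `|z| 1; last by rewrite noise_vanish.
by apply: cmax; rewrite in_itv /= -ler_norml.
Qed.

(** The derivative is continuous, hence bounded on the compact interval where
    the mean value theorem is applied. *)
Lemma noise_lipschitz (r : R) : exists L : R, 0 <= L /\
  forall z w, `|z| <= r -> `|w| <= r -> `|q z - q w| <= L * `|z - w|.
Proof.
have [r0|r0] := leP 0 r; last first.
  by exists 0; split=> // z w zr; have := le_lt_trans zr r0; rewrite ltNge normr_ge0.
have cq' : continuous (fun z => `|derive1 q z|).
  by move=> z; apply: cvg_norm; exact: (@noise_C1 _ _ q_noise z).
have [|c _ cmax] := @EVT_max R _ (- r) r _ (continuous_subspaceT cq').
  lra.
exists `|derive1 q c|; split => // z w zr wr.
wlog zw : z w zr wr / z < w.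
  move=> H; have [zw|wz|->] := ltgtP z w; first exact: H.
  - by rewrite distrC [X in _ * X]distrC; exact: H.
  - by rewrite !subrr normr0 mulr0.
have [|v vzw qE] := @MVT R q (derive1 q) z w zw _
    (continuous_subspaceT noise_continuous).
  by move=> v _; rewrite derive1E; apply/derivableP; exact: noise_derivable.
rewrite distrC [X in _ * X]distrC qE normrM ler_wpM2r//.
apply: cmax; move: vzw zr wr; rewrite !in_itv /= !ler_norml.
by move=> /andP[? ?] /andP[? ?] /andP[? ?]; apply/andP; split; lra.
Qed.

Definition noise_cdf (t : R) : R := \int[mu]_(z in `]-oo, t]) q z.

Let iq : mu.-integrable [set: R] (EFin \o q).
Proof.
apply/integrableP; split.
  by apply/measurable_EFinP; exact: continuous_measurable_fun noise_continuous.
under eq_integral do rewrite gee0_abs ?lee_fin//.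
by rewrite (noise_int q_noise) ltry.
Qed.

Lemma is_derive_noise_cdf (t : R) : is_derive t (1 : R) noise_cdf (q t).
Proof.
have [||||d e] := @continuous_FTC1 R q -oo%O t (t + 1).
- by rewrite ltrDl.
- by apply: integrableS iq.
- by rewrite ltNyr.
- exact: noise_continuous.
by rewrite -e derive1E; exact/derivableP.
Qed.

Lemma noise_cdf_right t : 1 <= t -> noise_cdf t = 1.
Proof.
move=> t1; rewrite /noise_cdf /Rintegral integral_mkcond.
rewrite -[RHS]/(fine 1%E) -(noise_int q_noise); congr fine.
apply: eq_integral => x _; rewrite patchE; case: ifPn => //.
rewrite notin_setE /= in_itv /= => /negP; rewrite -ltNge => tx.
by rewrite noise_vanish// ltr_normr (le_lt_trans t1 tx).
Qed.

Lemma noise_cdf_left t : t < -1 -> noise_cdf t = 0.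
Proof.
move=> t1; rewrite /noise_cdf /Rintegral integral_mkcond.
rewrite -[RHS]/(fine 0%E) -(integral0 mu setT); congr fine.
apply: eq_integral => x _; rewrite patchE; case: ifPn => //.
rewrite inE /= in_itv /= => xt.
by rewrite noise_vanish// ltr_normr ltrNr (le_lt_trans xt t1) orbT.
Qed.

Variable d : R.
Hypotheses (d_gt0 : 0 < d) (d_lt : d < 4^-1).

(** The terms n = -1, 0, 1 of the periodized kernel at [u = x - y]. *)
Definition wrapped_noise (u : R) : R :=
  d^-1 * q ((u - 1) / d) + d^-1 * q (u / d) + d^-1 * q ((u + 1) / d).

Let d_lt1 : d < 1.
Proof. by apply: lt_trans d_lt _; rewrite invf_lt1// ltr1n. Qed.

(** For [x] and [y] in the unit interval, a translation by at least 2 in absolute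
    value takes [x - y] at distance at least 1 > [d] from 0, where the noise
    vanishes. *)
Lemma qper_wrapped x y : I x -> I y -> qper q d x y = wrapped_noise (x - y).
Proof.
move=> Ix Iy.
have xy : `|x - y| <= 1.
  move: Ix Iy; rewrite /unit_itv /= !in_itv /= => /andP[? ?] /andP[? ?].
  by rewrite ler_norml; apply/andP; split; lra.
have -> : qper q d x y =
    \sum_(n <- [:: -1; 0; 1] : seq int) d^-1 * q ((x - y + n%:~R) / d).
  rewrite fsbig_seq//; apply/esym; apply: fsbig_widen => //.
  move=> n [_ /= nin]; rewrite noise_vanish ?mulr0//.
  rewrite normrM (gtr0_norm (_ : 0 < d^-1)) ?invr_gt0// ltr_pdivlMr// mul1r.
  have n2 : 2 <= `|n%:~R : R|.
    rewrite -intr_norm (_ : 2 = (2%:Z)%:~R)// ler_int.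
    move: nin; rewrite !inE => /negP; rewrite !negb_or => /and3P[].
    by case: n => [[|[|n]]|[|n]].
  have := lerB_normD (n%:~R : R) (x - y).
  rewrite [n%:~R + _]addrC => h.
  apply: lt_le_trans h; have d1 := d_lt1.
  lra.
by rewrite !big_cons big_nil addr0 addr0 mulrN1z !addrA.
Qed.

Lemma wrapped_noise_ge0 u : 0 <= wrapped_noise u.
Proof. by rewrite /wrapped_noise !addr_ge0// mulr_ge0// invr_ge0 ltW. Qed.

Lemma wrapped_noise_bounded : exists M, forall u, wrapped_noise u <= M.
Proof.
have [M qM] := noise_bounded; exists (d^-1 * M + d^-1 * M + d^-1 * M) => u.
by rewrite /wrapped_noise !lerD// ler_pM2l ?invr_gt0.
Qed.

Lemma wrapped_noise_continuous : continuous wrapped_noise.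
Proof.
move=> u; rewrite /wrapped_noise.
have lin (c : R) :
    (fun u : R => d^-1 * q ((u + c) / d)) @ u --> d^-1 * q ((u + c) / d).
  apply: cvgM; first exact: cvg_cst.
  apply: (@continuous_comp R R R (fun u : R => (u + c) / d) q); last first.
    exact: noise_continuous.
  by apply: cvgM; [apply: cvgD; [exact: cvg_id|exact: cvg_cst]|exact: cvg_cst].
apply: cvgD; last exact: lin.
apply: cvgD; first exact: lin.
by have := lin 0; under eq_fun do rewrite addr0; rewrite addr0.
Qed.

Lemma wrapped_noise_lipschitz : exists L : R, 0 <= L /\
  forall u v, `|u| <= 1 -> `|v| <= 1 ->
  `|wrapped_noise u - wrapped_noise v| <= L * `|u - v|.
Proof.
have [L [L0 qL]] := noise_lipschitz (2 / d).
exists (3 * (d^-1 * (L * d^-1))); split.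
  by rewrite !mulr_ge0 ?invr_ge0// ltW.
move=> u v u1 v1.
have lin (c : R) : `|c| <= 1 ->
    `|d^-1 * q ((u + c) / d) - d^-1 * q ((v + c) / d)| <=
    d^-1 * (L * d^-1) * `|u - v|.
  move=> c1; rewrite -mulrBr normrM (gtr0_norm (_ : 0 < d^-1)) ?invr_gt0//.
  rewrite -mulrA ler_pM2l ?invr_gt0//.
  apply: le_trans (qL _ _ _ _) _.
  - rewrite normrM (gtr0_norm (_ : 0 < d^-1)) ?invr_gt0// ler_pM2r ?invr_gt0//.
    by apply: le_trans (ler_normD _ _) _; lra.
  - rewrite normrM (gtr0_norm (_ : 0 < d^-1)) ?invr_gt0// ler_pM2r ?invr_gt0//.
    by apply: le_trans (ler_normD _ _) _; lra.
  - rewrite -mulrBl opprD addrACA subrr addr0 normrM.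
    rewrite (gtr0_norm (_ : 0 < d^-1)) ?invr_gt0//.
    by rewrite (_ : _ * (_ * _) = L / d * `|u - v|)//; ring.
have := lin (-1); rewrite normrN normr1 => /(_ (lexx _)) h1.
have := lin 0; rewrite normr0 !addr0 => /(_ ler01) h2.
have := lin 1; rewrite normr1 => /(_ (lexx _)) h3.
rewrite /wrapped_noise.
set a1 := d^-1 * q ((u - 1) / d) in h1 *; set a2 := d^-1 * q (u / d) in h2 *.
set a3 := d^-1 * q ((u + 1) / d) in h3 *; set b1 := d^-1 * q ((v - 1) / d) in h1 *.
set b2 := d^-1 * q (v / d) in h2 *; set b3 := d^-1 * q ((v + 1) / d) in h3 *.
have -> : a1 + a2 + a3 - (b1 + b2 + b3) = (a1 - b1) + (a2 - b2) + (a3 - b3) by ring.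
apply: le_trans (ler_normD _ _) _.
have := ler_normD (a1 - b1) (a2 - b2).
lra.
Qed.

(** A primitive of the integrand is the sum of three translates of the
    distribution function, whose increment telescopes over the unit interval:
    only its values at [(2 - y) / d >= 1] and [(- y - 1) / d < -1] remain. *)
Lemma integral_wrapped_noise y : I y ->
  (\int[mu]_(x in I) (wrapped_noise (x - y))%:E = 1)%E.
Proof.
move=> Iy.
pose F (c x : R) := noise_cdf ((x - y + c) / d).
pose G := F (- 1) + F 0 + F 1.
have dF (c x : R) : is_derive x (1 : R) (F c) (d^-1 * q ((x - y + c) / d)).
  rewrite mulrC.
  apply: (@is_derive1_comp _ noise_cdf (fun x => (x - y + c) / d)).
    exact: is_derive_noise_cdf.
  rewrite (_ : (fun x => _) = d^-1 \*: ((@idfun R) + cst (c - y))); last first.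
    apply/funext => z; rewrite /= /GRing.scale /= mulrC; congr (_ * _).
    by rewrite /cst -addrA [- y + _]addrC.
  apply: (is_derive_eq (is_deriveZ d^-1
    (is_deriveD (is_derive_id x 1) (is_derive_cst (c - y) x 1)))).
  by rewrite addr0 /GRing.scale /= mulr1.
have dG (x : R) : is_derive x (1 : R) G (wrapped_noise (x - y)).
  apply: (is_derive_eq (is_deriveD (is_deriveD (dF (- 1) x) (dF 0 x)) (dF 1 x))).
  by rewrite /wrapped_noise addr0.
have cG : continuous G.
  move=> x; apply: differentiable_continuous; apply/derivable1_diffP.
  by have [] := dG x.
rewrite /unit_itv (@continuous_FTC2 _ _ G)//.
- rewrite -EFinB; congr (_%:E).
  rewrite -[G 1]/(F (- 1) 1 + F 0 1 + F 1 1) -[G 0]/(F (- 1) 0 + F 0 0 + F 1 0) /F.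
  move: Iy; rewrite /unit_itv /= in_itv /= => /andP[y0 y1].
  rewrite !addr0 (_ : 1 - y + - 1 = - y); last by ring.
  rewrite sub0r (addrC (- y) 1).
  rewrite (noise_cdf_right (_ : 1 <= (1 - y + 1) / d)); last first.
    by rewrite ler_pdivlMr//; have d1 := d_lt1; lra.
  rewrite (noise_cdf_left (_ : (- y - 1) / d < -1)); last first.
    by rewrite ltr_pdivrMr//; have d1 := d_lt1; lra.
  by ring.
- apply: continuous_subspaceT => x.
  apply: (@continuous_comp _ _ _ (fun x => x - y) wrapped_noise).
    by apply: cvgB; [exact: cvg_id|exact: cvg_cst].
  exact: wrapped_noise_continuous.
- split.
  + by move=> x _; have [] := dG x.
  + exact: cvg_at_right_filter (cG 0).
  + exact: cvg_at_left_filter (cG 1).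
- by move=> x _; rewrite derive1E; have [_ ->] := dG x.
Qed.

End noise_profile.

End noise_kernel.

(** * Lipschitz functions have bounded variation *)

Section lipschitz_variation.
Context (R : realType).
Local Notation mu := (@lebesgue_measure R).
Local Notation I := (@unit_itv R).

(** Oscillations are suprema over uncountable families, whose measurability is
    not obvious; monotonicity of the integral of nonnegative functions is
    immediate from its definition as a supremum over simple functions. *)
Lemma ge0_le_integral_nomeas d (T : measurableType d) (m : {measure set T -> \bar R})
    (D : set T) (f g : T -> \bar R) :
  (forall x, D x -> 0 <= f x)%E -> (forall x, D x -> f x <= g x)%E ->
  (\int[m]_(x in D) f x <= \int[m]_(x in D) g x)%E.
Proof.
move=> f0 fg; rewrite !ge0_integralE//; last first.
  by move=> x Dx; apply: le_trans (fg _ Dx); exact: f0.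
apply: ereal_sup_le => _ [h /= hf <-]; exists h => //= x.
apply: (le_trans (hf x)); rewrite !patchE; case: ifPn => //.
by rewrite inE; exact: fg.
Qed.

Lemma lebesgue_measure_unit_itv : mu I = 1%E.
Proof.
by rewrite /unit_itv lebesgue_measure_itv /= lte_fin ltr01 oppr0 adde0.
Qed.

(** The oscillation at scale [r] is at most [2 * L * r], and [r] is at most
    [r `^ p^-1] since [r <= 1 <= p]. *)
Lemma lipschitz_var_fun (p L : R) (h : R -> R) : 1 <= p -> 0 <= L ->
  (forall x y, I x -> I y -> `|h x - h y| <= L * `|x - y|) ->
  (var_fun p h <= (2 * L)%:E)%E.
Proof.
move=> p1 L0 hL; apply: ge_ereal_sup => _ [r /= + <-].
rewrite in_itv /= => /andP[r0 r1].
have Osc_le x : (Osc h r x <= (L * (2 * r))%:E)%E.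
  apply: ge_ereal_sup => _ [y1 [+ Iy1]] [y2 [+ Iy2]] <-.
  rewrite /= !in_itv /= => /andP[? ?] /andP[? ?].
  rewrite lee_fin; apply: (le_trans (hL _ _ Iy1 Iy2)); apply: ler_wpM2l => //.
  by rewrite ler_norml; apply/andP; split; lra.
have Osc_ge0 x : I x -> (0 <= Osc h r x)%E.
  move=> Ix; have Jx : (`]x - r, x + r[%classic `&` I) x.
    by split => //; rewrite /= in_itv /=; apply/andP; split; lra.
  by apply: ereal_sup_ubound; exists x => //; exists x => //; rewrite subrr normr0.
have Osc1_le : (Osc1 h r <= (L * (2 * r))%:E)%E.
  apply: (@le_trans _ _ (\int[mu]_(x in I) (L * (2 * r))%:E)%E).
    exact: ge0_le_integral_nomeas.
  rewrite integral_cst; last exact: measurable_itv.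
  by rewrite [X in (_ * X)%E]lebesgue_measure_unit_itv mule1.
apply: (@le_trans _ _ ((r `^ (- p^-1))%:E * (L * (2 * r))%:E)%E).
  by apply: lee_wpmul2l => //; rewrite lee_fin powR_ge0.
rewrite -EFinM lee_fin powRN.
have rp : r <= r `^ p^-1.
  by apply: ger1_powR; [rewrite r0 r1|rewrite invf_le1//; lra].
have rp0 : 0 < r `^ p^-1 by exact: lt_le_trans rp.
rewrite mulrC ler_pdivrMr//.
rewrite (_ : L * (2 * r) = 2 * L * r); last by ring.
by apply: ler_wpM2l => //; rewrite mulr_ge0.
Qed.

Lemma lipschitz_BV (p L : R) (h : R -> R) : 1 <= p -> 0 <= L ->
  measurable_fun I h -> L1 h ->
  (forall x y, I x -> I y -> `|h x - h y| <= L * `|x - y|) -> BV p h.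
Proof.
move=> p1 L0 mh ih hL; split => //.
apply: (@le_lt_trans _ _ (2 * L)%:E); last exact: ltry.
apply: le_trans (lipschitz_var_fun p1 L0 hL).
by apply: ereal_inf_lbound; exists h => //; split => //; exact: ae_eq_refl.
Qed.

End lipschitz_variation.

(** * The invariant density of the noisy map *)

Section unit_interval_measure.
Context (R : realType).
Local Notation mu := (@lebesgue_measure R).
Local Notation I := (@unit_itv R).

Lemma measurable_unit_itv : measurable (I : set (measurableTypeR R)).
Proof. exact: measurable_itv. Qed.

Lemma lebesgue_measure_unit_itv_lty : (mu I < +oo)%E.
Proof. by rewrite lebesgue_measure_unit_itv ltry. Qed.

Definition lebesgue_unit : {finite_measure set (measurableTypeR R) -> \bar R} :=
  mfrestr measurable_unit_itv lebesgue_measure_unit_itv_lty.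

Lemma integral_lebesgue_unit (f : R -> \bar R) : measurable_fun [set: R] f ->
  (forall x, 0 <= f x)%E ->
  (\int[lebesgue_unit]_x f x = \int[mu]_(x in I) f x)%E.
Proof.
move=> mf f0.
rewrite (@ge0_negligible_integral _ _ _ lebesgue_unit setT (~` I))//; last 2 first.
- by apply: measurableC; exact: measurable_unit_itv.
- by rewrite /lebesgue_unit /= /mfrestr /mrestr setICl measure0.
rewrite setTD setCK; apply: eq_measure_integral => A mA AI.
by rewrite /lebesgue_unit /= /mfrestr /mrestr setIidl.
Qed.

End unit_interval_measure.

Section noisy_map.
Context (R : realType) (s e : R) (tau q : R -> R) (d : R).
Hypotheses (tauT : class_T s e tau) (q_noise : noise_profile q)
  (d_gt0 : 0 < d) (d_lt : d < 4^-1).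
Local Notation mu := (@lebesgue_measure R).
Local Notation I := (@unit_itv R).
Local Notation m := (lebesgue_unit R).

Let tauI : {homo tau : x / I x}. Proof. by have [] := tauT. Qed.
Let mtau := class_T_measurable tauT.

Let t : R -> R := tau \_ I.

Let tI x : I (t x).
Proof.
rewrite /t patchE; case: ifPn => [|_]; first by rewrite inE; exact: tauI.
by rewrite /unit_itv /= in_itv /= lexx ler01.
Qed.

Let mt : measurable_fun [set: R] t.
Proof. by exact/(measurable_restrictT _ (@measurable_unit_itv R)). Qed.

(* [t] takes all its values in the unit interval, so that the bound and the total
   mass of [K] hold for every [z]. *)
Let K (x z : R) := wrapped_noise q d (x - t z).

Let mw : measurable_fun [set: R] (wrapped_noise q d).
Proof. by apply: continuous_measurable_fun; exact: wrapped_noise_continuous. Qed.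

Lemma noisy_kernel_measurable : measurable_fun [set: R * R] (fun w => K w.1 w.2).
Proof.
apply: (measurableT_comp mw); apply: measurable_funB; first exact: measurable_fst.
by apply: (measurableT_comp mt); exact: measurable_snd.
Qed.

Lemma noisy_kernel_stochastic z : (\int[m]_x (K x z)%:E = 1)%E.
Proof.
rewrite integral_lebesgue_unit.
- exact: integral_wrapped_noise.
- apply/measurable_EFinP; apply: (measurableT_comp mw).
  exact: measurable_funB.
- by move=> x; rewrite lee_fin; exact: wrapped_noise_ge0.
Qed.

(** The noise makes the kernel Lipschitz in its first variable, uniformly in the
    second; an invariant function is an average of such functions with weights
    of total mass 1, so it inherits the Lipschitz constant. *)
Lemma noisy_invariant_density : exists (h : R -> R) B L,
  [/\ measurable_fun [set: R] h, (forall x, 0 <= h x <= B),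
      (\int[m]_x (h x)%:E = 1)%E,
      (forall x, kernel_op m K h x = h x) &
      0 <= L /\ forall x y, I x -> I y -> `|h x - h y| <= L * `|x - y|].
Proof.
have [M KM] := wrapped_noise_bounded q_noise d_gt0.
have Kb x z : 0 <= K x z <= M by rewrite wrapped_noise_ge0//= KM.
have [h [B [mh hB h1 hK]]] := @markov_invariant_density _ _ R m K M
  noisy_kernel_measurable Kb noisy_kernel_stochastic.
have [L [L0 wL]] := wrapped_noise_lipschitz q_noise d_gt0.
exists h, B, L; split => //; split => // x y Ix Iy.
have iK x' := @kernel_integrable _ _ R m K M noisy_kernel_measurable Kb h B x' mh hB.
have ih := @bounded_integrable _ _ R m h B mh hB.
rewrite -(hK x) -(hK y) /kernel_op -RintegralB//; [|exact: (iK x)|exact: (iK y)].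
have iD : m.-integrable [set: R] (EFin \o (fun z => K x z * h z - K y z * h z)).
  by have := integrableB measurableT (iK x) (iK y); apply: eq_integrable.
apply: (le_trans (le_normr_Rintegral measurableT iD)).
have Ih : \int[m]_z h z = 1 by rewrite /Rintegral h1.
rewrite -[leRHS]mulr1 -[in leRHS]Ih -RintegralZl//.
apply: le_Rintegral => //.
- exact: integrable_norm iD.
- by have := integrableZl measurableT (L * `|x - y|) ih; apply: eq_integrable.
- move=> z _; have /andP[h0 _] := hB z.
  rewrite -mulrBl normrM (ger0_norm h0) ler_wpM2r//.
  have dist_le1 u v : I u -> I v -> `|u - v| <= 1.
    rewrite /unit_itv /= !in_itv /= => /andP[? ?] /andP[? ?].
    by rewrite ler_norml; apply/andP; split; lra.
  apply: (le_trans (wL _ _ (dist_le1 _ _ Ix (tI z)) (dist_le1 _ _ Iy (tI z)))).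
  by rewrite opprB addrA subrK.
Qed.

(** By duality the composition of the transfer and noise operators is an integral
    operator, with kernel the noise kernel at [x - tau z]. *)
Lemma noisy_transfer_kernel (h : R -> R) B x :
  measurable_fun [set: R] h -> (forall x, 0 <= h x <= B) -> I x ->
  noisy_transfer tau q d h x = kernel_op m K h x.
Proof.
move=> mh hB Ix.
have h0 z : 0 <= h z by have /andP[] := hB z.
have ih : L1 h.
  apply: measurable_bounded_integrable.
  - exact: measurable_unit_itv.
  - exact: lebesgue_measure_unit_itv_lty.
  - exact: measurable_funTS.
  - exists B; split; first exact: num_real.
    move=> C BC z _; have /andP[_ hz] := hB z.
    by rewrite /= ger0_norm// (le_trans hz)// ltW.
rewrite /noisy_transfer /noise_op /kernel_op /Rintegral; congr fine.
transitivity (\int[mu]_(y in I) (wrapped_noise q d (x - y) * transfer tau h y)%:E)%E.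
  by apply: eq_integral => y; rewrite inE => Iy; rewrite qper_wrapped.
rewrite (@integral_transfer R tau _ _ _ h (fun y => wrapped_noise q d (x - y)))//.
- rewrite integral_lebesgue_unit.
  + apply: eq_integral => y yI.
    by rewrite /K /t patchE yI.
  + apply/measurable_EFinP; apply: measurable_funM => //.
    exact: (measurable_fun_pair2 x noisy_kernel_measurable).
  + by move=> z; rewrite lee_fin mulr_ge0// wrapped_noise_ge0.
- exact: class_T_nonsingular tauT.
- by apply: (measurableT_comp mw); exact: measurable_funB.
- by move=> y; exact: wrapped_noise_ge0.
Qed.

End noisy_map.

Theorem theorem4p1 (R : realType) (p s e : R) (tau q : R -> R) (alpha0 C0 : R)
  (p_ge1 : 1 <= p) (s_gt1 : 1 < s) (e_gt0 : 0 < e)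
  (tauT : class_T s e tau)
  (q_noise : noise_profile q)
  (tau_LY : lasota_yorke p s tau alpha0 C0)
  (joint : alpha0 < (Ctilde1 p q)^-1)
  (d : R) (d_gt0 : 0 < d) (d_lt : d < 4^-1) :
  exists h : R -> R,
    [/\ BV p h,
        ae_eq lebesgue_measure unit_itv (noisy_transfer tau q d h) h,
        {ae lebesgue_measure, forall x, unit_itv x -> 0 <= h x} &
        L1norm h = 1%E].
Proof.
have [h [B [L [mh hB h1 hK [L0 hL]]]]] :=
  noisy_invariant_density tauT q_noise d_gt0 d_lt.
have h0 z : 0 <= h z by have /andP[] := hB z.
have Ih : (\int[lebesgue_measure]_(x in unit_itv) (h x)%:E = 1)%E.
  rewrite -h1 integral_lebesgue_unit//; first exact/measurable_EFinP.
exists h; split.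
- apply: (lipschitz_BV p_ge1 L0) hL; first exact: measurable_funTS.
  apply/integrableP; split.
    by apply/measurable_EFinP; exact: measurable_funTS.
  under eq_integral do rewrite gee0_abs ?lee_fin//.
  by rewrite Ih ltry.
- apply: aeW => x Ix.
  by rewrite (noisy_transfer_kernel tauT q_noise d_gt0 d_lt mh hB Ix) hK.
- by apply: aeW => x _.
- rewrite /L1norm; under eq_integral do rewrite gee0_abs ?lee_fin//.
  exact: Ih.
Qed.
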